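(* Let $\alpha \in (0,2]$, $\gamma = \alpha/2 \in (0,1]$ and $\sigma > 0$. For every real $a > 0$, the function $$g(t,a) = \exp\left\{-\sigma^{2\gamma}\,\frac{2^{\gamma}}{a^{2\gamma}}\,\bigl(1-\cos(at)\bigr)^{\gamma}\right\}, \qquad t \in \mathbb{R},$$ is the characteristic function of a probability distribution on the lattice $a\mathbb{Z} = \{0, \pm a, \pm 2a, \dots\}$.
   Context: The characteristic function of a probability distribution $\mu$ on $\mathbb{R}$ is $t \mapsto \int_{\mathbb{R}} e^{\mathrm{i} t x}\,\mu(\mathrm{d}x)$, $t\in\mathbb{R}$. A distribution $\mu$ is on the lattice $a\mathbb{Z}$ if $\mu(a\mathbb{Z}) = 1$. *)

(* Defs.v *)
From mathcomp Require Export all_boot all_order all_algebra.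
From mathcomp Require Export complex.
From mathcomp Require Export all_classical all_reals all_analysis.
Import Order.TTheory GRing.Theory Num.Theory.
Import numFieldNormedType.Exports.

#[export] Set Implicit Arguments.
#[export] Unset Strict Implicit.
#[export] Unset Printing Implicit Defensive.

Local Open Scope classical_set_scope.
Local Open Scope ring_scope.
Local Open Scope complex_scope.

Definition cexp (R : realType) (z : R[i]) : R[i] :=
  (expR (complex.Re z))%:C * (cos (complex.Im z) +i* sin (complex.Im z)).

(* Componentwise integral. As with [Rintegral], it is only meaningful when the
   real and imaginary parts of [f] are integrable; this always holds below,
   where [f] is continuous and bounded and [mu] is a probability. *)
Definition Cintegral d (T : measurableType d) (R : realType)
    (mu : {measure set T -> \bar R}) (f : T -> R[i]) : R[i] :=
  Rintegral mu setT (fun x => complex.Re (f x)) +i*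
  Rintegral mu setT (fun x => complex.Im (f x)).

Definition char_fun (R : realType)
    (mu : probability (measurableTypeR R) R) (t : R) : R[i] :=
  Cintegral mu (fun x : R => cexp ('i%C * (t * x)%:C)).

Definition lattice (R : realType) (a : R) : set R :=
  [set a * k%:~R | k in [set: int]].

Definition on_lattice (R : realType)
    (mu : probability (measurableTypeR R) R) (a : R) : Prop :=
  mu (lattice a) = 1%E.

Definition g (R : realType) (gamma sigma t a : R) : R :=
  expR (- (sigma `^ (2 * gamma) * (2 `^ gamma / a `^ (2 * gamma)) *
           (1 - cos (a * t)) `^ gamma)).

(* Main.v *)
From HB Require Import structures.
Require Import Defs.
From mathcomp Require Import measurable_realfun ring lra.
Import Order.TTheory GRing.Theory Num.Theory.
Import numFieldNormedType.Exports.
Local Open Scope classical_set_scope.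
Local Open Scope ring_scope.
Local Open Scope complex_scope.

(** Put u = cos (a t), the characteristic function of a fair sign times a.
    For 0 < gamma <= 1 the binomial series

      1 - (1 - u)^gamma = sum_(k >= 0) b_k u^(k+1),        |u| <= 1,

    has nonnegative coefficients, and setting u = 1 shows that they add up
    to 1. Hence psi(t) = 1 - (1 - cos (a t))^gamma is the characteristic
    function of a simple random walk of step a, stopped at an independent
    random time equal to k + 1 with probability b_k. With c the constant in
    front of (1 - cos (a t))^gamma,

      g(t, a) = exp (c (psi(t) - 1)) = sum_m e^(-c) c^m / m! psi(t)^m

    is then a compound Poisson characteristic function. Every step stays
    inside the class of real characteristic functions of distributions
    on the lattice ([lattice_cf]): this class contains cos (a t)
    ([lattice_cf_cos]) and is stable under products, by convolution
    ([lattice_cfM]), and under countable mixtures ([lattice_cf_mixture]).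

    The expansion of (1 - u)^gamma up to and including the endpoints
    ([binrem_cvg]) comes from a differential equation for the polynomials
    T_n(u) = 1 - sum_(k < n) b_k u^(k+1): one has

      (1 - u) T_n' + gamma T_n = gamma r_n u^n,   r_n = T_n(1),

    so T_n (1 - u)^(-gamma) has derivative gamma r_n u^n (1 - u)^(-gamma-1),
    which tends to 0 uniformly on compact subsets of [-1, 1[ because r_n
    tends to 0 ([bintail_cvg0]). *)

(** * The binomial series of (1 - z)^gamma on [-1, 1] *)

Section BinomialSeries.
Variables (R : realType) (gamma : R).
Hypothesis gamma01 : 0 < gamma <= 1.

(** [bincoef k] is the coefficient b_k = (-1)^k binomial(gamma, k + 1) of z^(k+1)
    in 1 - (1 - z)^gamma, and [bintail n] = (-1)^n binomial(gamma - 1, n) is what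
    is left of 1 after subtracting the first n coefficients. The product form
    shows the signs, and makes the sum of the coefficients telescope. *)
Definition bintail n : R := \prod_(k < n) (1 - gamma / k.+1%:R).
Definition bincoef n : R := gamma * bintail n / n.+1%:R.
Definition binrem n (z : R) : R := 1 - \sum_(k < n) bincoef k * z ^+ k.+1.

Let gamma_div n : 0 <= gamma / n.+1%:R <= 1.
Proof.
have /andP[g0 g1] := gamma01; apply/andP; split.
  by rewrite divr_ge0// ltW.
by rewrite ler_pdivrMr ?ltr0n// mul1r (le_trans g1)// ler1n.
Qed.

Lemma bintailS n : bintail n.+1 = bintail n - bincoef n.
Proof. by rewrite /bintail big_ord_recr/= -/(bintail n) /bincoef; ring. Qed.

Lemma bintail_ge0 n : 0 <= bintail n.
Proof.
apply: prodr_ge0 => k _; rewrite subr_ge0.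
by have /andP[] := gamma_div k.
Qed.

Lemma bincoef_ge0 n : 0 <= bincoef n.
Proof.
have /andP[g0 _] := gamma01.
by rewrite divr_ge0// mulr_ge0// ?bintail_ge0// ltW.
Qed.

Lemma binrem1 n : binrem n 1 = bintail n.
Proof.
rewrite /binrem; elim: n => [|n IH]; first by rewrite big_ord0 subr0 /bintail big_ord0.
by rewrite big_ord_recr/= expr1n mulr1 bintailS -IH opprD addrA.
Qed.

Lemma bintail_noninc : nonincreasing_seq bintail.
Proof.
by apply/nonincreasing_seqP => n; rewrite bintailS gerBl bincoef_ge0.
Qed.

(** If the nonincreasing sequence [bintail] had a limit l > 0, then b_k would be
    at least gamma l / (k+1), and the partial sums of b_k, which are bounded
    by 1, would dominate a multiple of the harmonic series. *)
Lemma bintail_cvg0 : bintail @ \oo --> (0 : R).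
Proof.
have cb : cvgn bintail.
  apply: nonincreasing_is_cvgn; first exact: bintail_noninc.
  by exists 0 => _ [n _ <-]; exact: bintail_ge0.
set l := limn bintail.
have ll n : l <= bintail n by exact: (nonincreasing_cvgn_ge bintail_noninc cb).
have l0 : 0 <= l by apply: limr_ge => //; apply: nearW => n; exact: bintail_ge0.
suff -> : 0 = l by [].
apply/eqP; rewrite eq_le l0/= leNgt; apply/negP => lgt0.
have /andP[g0 _] := gamma01.
apply: (@dvg_harmonic R).
apply: nondecreasing_is_cvgn.
  by apply/nondecreasing_seqP => n; rewrite /series/= big_nat_recr//= lerDl.
exists (gamma * l)^-1 => _ [n _ <-].
rewrite -[leRHS]mul1r ler_pdivlMr ?mulr_gt0//.
rewrite /series/= big_mkord mulr_suml.
apply: (@le_trans _ _ (\sum_(k < n) bincoef k)).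
  apply: ler_sum => k _; rewrite /bincoef /harmonic mulrC.
  by rewrite ler_pM2r ?invr_gt0// ler_pM2l.
have := bintail_ge0 n; rewrite -binrem1 /binrem.
under eq_bigr do rewrite expr1n mulr1.
by lra.
Qed.

Definition dbinrem n (z : R) : R := - \sum_(k < n) gamma * bintail k * z ^+ k.

Lemma binremS n z : binrem n.+1 z = binrem n z - bincoef n * z ^+ n.+1.
Proof. by rewrite /binrem big_ord_recr/= opprD addrA. Qed.

Lemma dbinremS n z : dbinrem n.+1 z = dbinrem n z - gamma * bintail n * z ^+ n.
Proof. by rewrite /dbinrem big_ord_recr/= opprD. Qed.

Lemma is_derive_binrem n (z : R) : is_derive z (1 : R) (binrem n) (dbinrem n z).
Proof.
elim: n => [|n IH].
  have -> : binrem 0 = cst 1 by apply/funext => w; rewrite /binrem big_ord0 subr0.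
  by rewrite /dbinrem big_ord0 oppr0; exact: is_derive_cst.
have -> : binrem n.+1 = binrem n - bincoef n \*: (id ^+ n.+1 : R -> R).
  by apply/funext => w; rewrite binremS !fctE.
apply: is_derive_eq.
rewrite dbinremS; congr (_ - _).
by rewrite /bincoef /GRing.scale/= mulr1 mulrA divfK ?pnatr_eq0.
Qed.

(** The function (1 - z)^gamma solves (1 - z) y' + gamma y = 0; its partial sums
    solve the same equation up to a single monomial. *)
Lemma binrem_ode n z :
  (1 - z) * dbinrem n z + gamma * binrem n z = gamma * bintail n * z ^+ n.
Proof.
elim: n => [|n IH].
  by rewrite /dbinrem /binrem /bintail !big_ord0; ring.
rewrite dbinremS binremS.
by rewrite bintailS !exprS; lra.
Qed.

Let ler_powRN (r x y : R) : 0 <= r -> 0 < x -> x <= y ->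
  y `^ (- r) <= x `^ (- r).
Proof.
move=> r0 x0 xy; have y0 := lt_le_trans x0 xy.
by rewrite !powRN lef_pV2 ?posrE ?powR_gt0// ge0_ler_powR// nnegrE ltW.
Qed.

(** Dividing the partial sum by its expected limit (1 - w)^gamma removes the
    homogeneous part of the differential equation: only the small monomial is
    left in the derivative [dh]. *)
Let h n (w : R) := binrem n w * (1 - w) `^ (- gamma).
Let dh n (w : R) := gamma * bintail n * w ^+ n * (1 - w) `^ (- (gamma + 1)).

Let is_derive_h n (w : R) : w < 1 -> is_derive w (1 : R) (h n) (dh n w).
Proof.
move=> w1; have w0 : 0 < 1 - w by rewrite subr_gt0.
have d1 : is_derive w (1 : R) (fun w : R => 1 - w) (0 - 1).
  by apply: is_deriveB.
have dp := @is_derive1_comp R (fun u : R => u `^ (- gamma)) (fun w => 1 - w) w _ _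
  (is_derive1_powR (x := 1 - w) (- gamma) w0) d1.
have := is_deriveM (is_derive_binrem n w) dp.
move/is_derive_eq; apply.
rewrite /dh -binrem_ode opprD /=.
have -> : (1 - w) `^ (- gamma) = (1 - w) * (1 - w) `^ (- gamma - 1).
  rewrite -{1}(subrK 1 (- gamma)) powRD ?(gt_eqF w0) ?implybT//.
  by rewrite powRr1 ?(ltW w0)// mulrC.
by rewrite /GRing.scale/=; ring.
Qed.

Let h_lipschitz n (a b : R) : -1 <= a -> a <= b -> b < 1 ->
  `|h n b - h n a| <=
    gamma * bintail n * (1 - b) `^ (- (gamma + 1)) * (b - a).
Proof.
have /andP[g0 g1] := gamma01.
move=> a1 ab b1.
have hd w : w \in `[a, b] -> is_derive w (1 : R) (h n) (dh n w).
  by rewrite in_itv/= => /andP[_ wb]; apply: is_derive_h; exact: le_lt_trans b1.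
have ch : {within `[a, b], continuous (h n)}.
  by apply: derivable_within_continuous => w /hd dw; exact: ex_derive.
have hd' w : w \in `]a, b[ -> is_derive w (1 : R) (h n) (dh n w).
  by rewrite in_itv/= => /andP[/ltW aw /ltW wb]; apply: hd; rewrite in_itv/= aw.
have [c cab ->] := MVT_segment ab hd' ch.
rewrite normrM (ger0_norm (_ : 0 <= b - a)) ?subr_ge0//.
rewrite ler_wpM2r ?subr_ge0//.
rewrite /dh !normrM (ger0_norm (ltW g0)) (ger0_norm (bintail_ge0 n)).
rewrite (ger0_norm (powR_ge0 _ _)) -2!mulrA.
rewrite -[leRHS]mulrA ler_wpM2l ?(ltW g0)// ler_wpM2l ?bintail_ge0//.
move: cab; rewrite in_itv/= => /andP[ac cb].
rewrite -[leRHS]mul1r ler_pM ?powR_ge0//.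
  by rewrite normrX exprn_ile1// ler_norml; apply/andP; split; lra.
by apply: ler_powRN; lra.
Qed.

(** By the mean value inequality between 0 and z, the quotient [h n z] is within
    a multiple of [bintail n] of h n 0 = 1. At z = 1, where the denominator
    vanishes, the claim is [bintail_cvg0]. *)
Lemma binrem_cvg z : `|z| <= 1 ->
  (fun n => binrem n z) @ \oo --> (1 - z) `^ gamma.
Proof.
have /andP[g0 g1] := gamma01.
move=> zle1; have /andP[z1 z1'] : -1 <= z <= 1 by rewrite -ler_norml.
have [->|zN1] := eqVneq z 1.
  rewrite subrr powR0 ?gt_eqF//.
  under eq_fun do rewrite binrem1.
  exact: bintail_cvg0.
have zlt1 : z < 1 by rewrite lt_neqAle zN1.
have h0 n : h n 0 = 1.
  rewrite /h subr0 powR1 mulr1 /binrem big1 ?subr0// => k _.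
  by rewrite expr0n mulr0.
(* The factor (1 - w)^(-gamma-1) of the derivative is largest at the right end
   of the segment, which is z if z >= 0 and 0 otherwise: whence two terms. *)
pose K : R := 1 + (1 - z) `^ (- (gamma + 1)).
have hb n : `|1 - h n z| <= bintail n * (gamma * K).
  rewrite mulrCA mulrA -(h0 n) distrC; have [z0|z0] := leP 0 z.
    apply: le_trans (h_lipschitz n _ z0 zlt1) _; first lra.
    rewrite subr0 -[leRHS]mulr1 -!mulrA.
    rewrite ler_wpM2l ?(ltW g0)// ler_wpM2l ?bintail_ge0// ler_pM ?powR_ge0//.
    by rewrite /K lerDr.
  rewrite distrC; apply: le_trans (h_lipschitz n z1 (ltW z0) _) _; first lra.
  rewrite subr0 powR1 mulr1 sub0r.
  rewrite ler_wpM2l ?mulr_ge0 ?(ltW g0) ?bintail_ge0//.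
  by apply: (@le_trans _ _ 1); [lra|rewrite /K lerDl powR_ge0].
have E n : binrem n z = h n z * (1 - z) `^ gamma.
  rewrite /h -mulrA -powRD ?addNr ?powRr0 ?mulr1//.
  by rewrite (gt_eqF (_ : 0 < 1 - z)) ?implybT// subr_gt0.
under eq_fun do rewrite E.
suff hz1 : (fun n => h n z) @ \oo --> (1 : R).
  by have H := cvgMr_tmp (b := (1 - z) `^ gamma) hz1; rewrite mul1r in H; exact: H.
have bK : (fun n => bintail n * (gamma * K)) @ \oo --> (0 : R).
  by rewrite -(mul0r (gamma * K)); apply: cvgMr_tmp; exact: bintail_cvg0.
apply/cvgrPdist_le => e e0; move/cvgrPdist_le: bK => /(_ e e0).
apply: filterS => n; rewrite sub0r normrN => le_e.
by apply: le_trans (hb n) (le_trans (ler_norm _) le_e).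
Qed.

End BinomialSeries.

(** * Mixtures and products of probability measures *)

(** Bridge between the total mass of a series of measures, an extended real, and
    the convergence of real series used everywhere else. *)
Lemma nneseries_EFin (R : realType) (u : nat -> R) (l : R) :
  (forall n, 0 <= u n) ->
  (\sum_(n <oo) (u n)%:E)%E = l%:E <-> series u @ \oo --> l.
Proof.
move=> u0; have E : (fun n => \sum_(0 <= k < n) (u k)%:E)%E = EFin \o series u.
  by apply/funext => n; rewrite /= sumEFin.
split=> [ul|ul].
  have : cvgn (fun n => \sum_(0 <= k < n) (u k)%:E)%E.
    by apply: is_cvg_nneseries => n _ _; rewrite lee_fin.
  move=> /cvg_ex[l' hl'].
  have ll' : l' = l%:E by rewrite -ul; apply/esym/cvg_lim.
  by move: hl'; rewrite ll' E => /fine_cvgP[].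
apply/cvg_lim => //; rewrite E; apply: cvg_EFin => //.
exact: nearW.
Qed.

Section BoundedIntegrals.
Context d (T : measurableType d) (R : realType).
Implicit Types (P : probability T R) (f : T -> R) (M : R).

Lemma bounded_integrable P f M : measurable_fun setT f ->
  (forall x, `|f x| <= M) -> P.-integrable setT (EFin \o f).
Proof.
move=> mf fM; apply: measurable_bounded_integrable => //.
  by apply: le_lt_trans (ltry 1); rewrite -(probability_setT P).
exists M; split; first exact: num_real.
by move=> N MN x _; apply: le_trans (fM x) (ltW MN).
Qed.

(** Adding the bound M makes the integrand nonnegative, so that the theorems
    on integrals of nonnegative functions against scaled measures and series of
    measures apply to bounded functions of any sign. *)
Lemma integral_shift P f M : measurable_fun setT f ->
  (forall x, `|f x| <= M) ->
  (\int[P]_x (M + f x)%:E)%E = (M + Rintegral P setT f)%:E.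
Proof.
move=> mf fM.
have iM : P.-integrable setT (EFin \o cst M).
  by apply: (@bounded_integrable _ _ `|M|) => //; exact: measurable_cst.
have if_ := bounded_integrable P mf fM.
under eq_integral do rewrite EFinD.
rewrite integralD//; try exact: iM; try exact: if_.
rewrite [X in (X + _)%E](_ : _ = M%:E); last first.
  by rewrite integral_cst// -[RHS]mule1; congr (_ * _)%E; exact: probability_setT.
rewrite EFinD fineK//.
exact: integrable_fin_num.
Qed.

(** The mixture is the measure \sum_n w_n mu_n. The convergence of the real
    series is deduced from the extended-real one for M + f >= 0, by subtracting
    M times the series of the weights. *)
Lemma ex_mixture (mu_ : nat -> probability T R) (w : nat -> R) :
  (forall n, 0 <= w n) -> series w @ \oo --> (1 : R) ->
  exists mu : probability T R,
    (forall A, measurable A -> (forall n, mu_ n A = 1%E) -> mu A = 1%E) /\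
    forall f M, measurable_fun setT f -> (forall x, `|f x| <= M) ->
      series (fun n => w n * Rintegral (mu_ n) setT f) @ \oo
        --> Rintegral mu setT f.
Proof.
move=> w0 w1.
pose m := mseries (fun n => mscale (NngNum (w0 n)) (mu_ n)) 0.
have sumw : (\sum_(n <oo) (w n)%:E)%E = 1%E.
  exact: (proj2 (nneseries_EFin _ w0)).
have m1 A : measurable A -> (forall n, mu_ n A = 1%E) -> m A = 1%E.
  move=> mA A1; rewrite /m /mseries -sumw; apply: eq_eseriesr => n _.
  by rewrite -[RHS]mule1; congr (_ * _)%E; exact: A1.
have mT : m setT = 1%E by apply: m1 => // n; exact: probability_setT.
pose mP := Measure_isProbability.Build _ _ _ m mT.
pose mu : probability T R := HB.pack m mP.
exists mu; split=> // f M mf fM.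
have M0 x : 0 <= M + f x.
  by rewrite -lerBlDl sub0r; have := fM x; rewrite ler_norml => /andP[].
have I0 n : 0 <= M + Rintegral (mu_ n) setT f.
  by rewrite -lee_fin -integral_shift//; apply: integral_ge0 => x _; rewrite lee_fin.
have E : (\sum_(n <oo) (w n * (M + Rintegral (mu_ n) setT f))%:E)%E
    = (M + Rintegral mu setT f)%:E.
  have mMf : measurable_fun setT (EFin \o (fun x => M + f x) : T -> \bar R).
    by apply/measurable_EFinP; apply: measurable_funD.
  rewrite -(integral_shift mu mf fM).
  rewrite [RHS](ge0_integral_measure_series _ measurableT _ mMf); last first.
    by move=> x _; rewrite /= lee_fin.
  apply: eq_eseriesr => n _.
  rewrite [RHS](ge0_integral_mscale _ measurableT _ mMf); last first.
    by move=> x _; rewrite /= lee_fin.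
  by rewrite EFinM -(integral_shift (mu_ n) mf fM).
have C : series (fun n => w n * (M + Rintegral (mu_ n) setT f)) @ \oo
    --> M + Rintegral mu setT f.
  exact: (proj1 (nneseries_EFin _ (fun n => mulr_ge0 (w0 n) (I0 n))) E).
have -> : Rintegral mu setT f = M + Rintegral mu setT f - 1 * M.
  by rewrite mul1r addrAC subrr add0r.
have -> : series (fun n => w n * Rintegral (mu_ n) setT f) =
    (fun n => series (fun n => w n * (M + Rintegral (mu_ n) setT f)) n
              - series w n * M).
  apply/funext => n; rewrite /series/= mulr_suml -sumrB; apply: eq_bigr => i _.
  by rewrite mulrDr addrAC subrr add0r.
exact: cvgB C (cvgMr_tmp w1).
Qed.

End BoundedIntegrals.

Section ProductIntegrals.
Context d1 d2 (T1 : measurableType d1) (T2 : measurableType d2) (R : realType).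
Variables (P : probability T1 R) (Q : probability T2 R).
Variables (f : T1 -> R) (g : T2 -> R).
Hypotheses (mf : measurable_fun setT f) (f1 : forall x, `|f x| <= 1).
Hypotheses (mg : measurable_fun setT g) (g1 : forall x, `|g x| <= 1).

Lemma integrable_prod :
  (P \x Q)%E.-integrable setT (EFin \o (fun z => f z.1 * g z.2)).
Proof.
have mfg : measurable_fun setT (fun z : T1 * T2 => f z.1 * g z.2).
  by apply: measurable_funM; apply: measurableT_comp.
apply: (bounded_integrable (P \x Q)%E mfg (M := 1)) => z.
by rewrite normrM mulr_ile1.
Qed.

(** Independence turns the integral of a product into a product of integrals:
    this is what makes characteristic functions multiplicative. *)
Lemma Rintegral_prod :
  Rintegral (P \x Q)%E setT (fun z => f z.1 * g z.2) =
  Rintegral P setT f * Rintegral Q setT g.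
Proof.
have fi := bounded_integrable P mf f1.
have gi := bounded_integrable Q mg g1.
have ifg := integrable_prod.
rewrite -RintegralZr// [LHS]/Rintegral -integral12_prod_meas1//.
congr fine; apply: eq_integral => x _; rewrite /fubini_F/=.
under eq_integral do rewrite EFinM.
by rewrite integralZl// EFinM fineK//; exact: integrable_fin_num.
Qed.

End ProductIntegrals.

(** * Characteristic functions of lattice distributions *)

Section Lattice.
Variable R : realType.
Implicit Types (mu nu : probability (measurableTypeR R) R) (a t : R).

Lemma measurable_lattice a : @measurable _ (measurableTypeR R) (lattice a).
Proof.
apply: countable_measurable; first exact: measurable_set1.
exact: card_le_trans (card_image_le _ _) (countableP _).
Qed.

Lemma continuous_mul t : continuous (fun x : R => t * x).
Proof. by move=> x; apply: cvgM; [exact: cvg_cst|exact: cvg_id]. Qed.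

Lemma measurable_cosM t : measurable_fun setT (fun x : measurableTypeR R => cos (t * x)).
Proof.
apply: continuous_measurable_fun => x; apply: continuous_comp.
  exact: continuous_mul.
exact: continuous_cos.
Qed.

Lemma measurable_sinM t : measurable_fun setT (fun x : measurableTypeR R => sin (t * x)).
Proof.
apply: continuous_measurable_fun => x; apply: continuous_comp.
  exact: continuous_mul.
exact: continuous_sin.
Qed.

Lemma char_funE mu t : char_fun mu t =
  Rintegral mu setT (fun x => cos (t * x)) +i*
  Rintegral mu setT (fun x => sin (t * x)).
Proof.
rewrite /char_fun /Cintegral.
have E (x : R) : cexp ('i%C * (t * x)%:C) = cos (t * x) +i* sin (t * x).
  by rewrite /cexp /=; simpc; rewrite expR0 !mul1r.
by congr (_ +i* _); apply: eq_Rintegral => x _; rewrite E.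
Qed.

(** The law of the sum of two independent variables of laws mu and nu. It stays
    on the lattice since the lattice is closed under addition. *)
Lemma ex_convolution mu nu : exists rho : probability (measurableTypeR R) R,
  (forall t, char_fun rho t = char_fun mu t * char_fun nu t) /\
  forall a, on_lattice mu a -> on_lattice nu a -> on_lattice rho a.
Proof.
pose add2 (z : measurableTypeR R * measurableTypeR R) : measurableTypeR R := z.1 + z.2.
have madd : measurable_fun setT add2 by exact: measurable_funD.
pose X : {mfun _ >-> _} := HB.pack add2 (isMeasurableFun.Build _ _ _ _ _ madd).
exists (distribution (mu \x nu)%E X); split.
  move=> t; rewrite !char_funE.
  have D (f : R -> R) : measurable_fun setT (f : measurableTypeR R -> R) ->
      (forall x, `|f x| <= 1) ->
    Rintegral (distribution (mu \x nu)%E X) setT f =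
    Rintegral (mu \x nu)%E setT (fun z => f (z.1 + z.2)).
    move=> mf f1; rewrite /Rintegral integral_distribution//.
      exact/measurable_EFinP.
    apply: (bounded_integrable (mu \x nu)%E _ (M := 1)) => //.
    exact: measurableT_comp.
  rewrite D; [|exact: measurable_cosM|by move=> x; exact: cos_max].
  rewrite D; [|exact: measurable_sinM|by move=> x; exact: sin_max].
  have mc := measurable_cosM t; have ms := measurable_sinM t.
  have c1 (x : measurableTypeR R) : `|cos (t * x)| <= 1 by exact: cos_max.
  have s1 (x : measurableTypeR R) : `|sin (t * x)| <= 1 by exact: sin_max.
  simpc; congr (_ +i* _).
    rewrite -(Rintegral_prod mu nu mc c1 mc c1) -(Rintegral_prod mu nu ms s1 ms s1).
    rewrite -(RintegralB measurableT (integrable_prod mu nu mc c1 mc c1)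
                                     (integrable_prod mu nu ms s1 ms s1)).
    by apply: eq_Rintegral => z _; rewrite mulrDr cosD.
  rewrite -(Rintegral_prod mu nu mc c1 ms s1) -(Rintegral_prod mu nu ms s1 mc c1).
  rewrite -(RintegralD measurableT (integrable_prod mu nu mc c1 ms s1)
                                   (integrable_prod mu nu ms s1 mc c1)).
  by apply: eq_Rintegral => z _; rewrite mulrDr sinD addrC.
move=> a mua nua; apply/eqP; rewrite eq_le; apply/andP; split.
  by apply: probability_le1; exact: measurable_lattice.
have mL := measurable_lattice a.
(* The preimage of the lattice under addition contains its square. *)
have -> : (1 = (mu \x nu) (lattice a `*` lattice a))%E.
  rewrite product_measure1E// -[LHS]mule1.
  by congr (_ * _)%E; apply/esym; [exact: mua|exact: nua].
apply: le_measure; rewrite ?inE.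
- exact: measurableX.
- exact: (measurable_funPTI X mL).
- move=> [x y] /= [[k _ <-] [l _ <-]]; exists (k + l) => //.
  by rewrite intrD mulrDr.
Qed.

Lemma dirac_char_fun (x : measurableTypeR R) t :
  char_fun (\d_x : probability _ R) t = cos (t * x) +i* sin (t * x).
Proof.
have D (f : measurableTypeR R -> R) : measurable_fun setT f ->
    Rintegral (\d_x : probability _ R) setT f = f x.
  move=> mf; transitivity (fine (\int[\d_x]_(y in [set: measurableTypeR R]) (f y)%:E)) => //.
  by rewrite integral_dirac ?diracT ?mul1e//; apply/measurable_EFinP.
rewrite char_funE D; last exact: measurable_cosM.
by rewrite D//; exact: measurable_sinM.
Qed.

(** Only real-valued characteristic functions, those of symmetric distributions,
    are needed: their sine integrals vanish, so that a mixture is controlled by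
    a single real series. *)
Definition lattice_cf a (phi : R -> R) := exists mu,
  on_lattice mu a /\ forall t, char_fun mu t = (phi t)%:C.

Lemma eq_lattice_cf a phi psi : phi =1 psi -> lattice_cf a phi -> lattice_cf a psi.
Proof. by move=> /funext ->. Qed.

Lemma lattice_cf_mixture a (phi : nat -> R -> R) (w : nat -> R) (psi : R -> R) :
  (forall n, lattice_cf a (phi n)) ->
  (forall n, 0 <= w n) -> series w @ \oo --> (1 : R) ->
  (forall t, series (fun n => w n * phi n t) @ \oo --> psi t) ->
  lattice_cf a psi.
Proof.
move=> /choice[mu_ mu_phi] w0 w1 wpsi.
have [mu [mu1 mu_int]] := ex_mixture mu_ w0 w1.
exists mu; split=> [|t].
  by apply: mu1 => [|n]; [exact: measurable_lattice|case: (mu_phi n)].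
have cosE n : Rintegral (mu_ n) setT (fun x => cos (t * x)) = phi n t.
  by have [_ /(_ t)] := mu_phi n; rewrite char_funE => -[].
have sinE n : Rintegral (mu_ n) setT (fun x => sin (t * x)) = 0.
  by have [_ /(_ t)] := mu_phi n; rewrite char_funE => -[].
rewrite char_funE; congr (_ +i* _).
  have wc : (fun n => w n * Rintegral (mu_ n) setT (fun x => cos (t * x))) =
      (fun n => w n * phi n t) by apply/funext => n; congr (_ * _); exact: cosE.
  have := mu_int _ 1 (measurable_cosM t) (fun x => cos_max (t * x)).
  by rewrite wc => muc; apply: cvg_unique muc (wpsi t).
have ws : (fun n => w n * Rintegral (mu_ n) setT (fun x => sin (t * x))) =
    cst 0 by apply/funext => n; rewrite -[RHS](mulr0 (w n)); congr (_ * _); exact: sinE.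
have := mu_int _ 1 (measurable_sinM t) (fun x => sin_max (t * x)).
rewrite ws (_ : series _ = cst 0).
  by move=> mus; apply: cvg_unique mus (cvg_cst _).
by apply/funext => n; rewrite /series/= big1.
Qed.

Lemma dirac_on_lattice a (x : measurableTypeR R) :
  lattice a x -> on_lattice (\d_x : probability _ R) a.
Proof.
by move=> ax; rewrite /on_lattice; transitivity (\d_x (lattice a) : \bar R) => //;
  rewrite diracE mem_set.
Qed.

Lemma lattice_cf1 a : lattice_cf a (cst 1).
Proof.
exists (\d_(0 : measurableTypeR R)); split=> [|t].
  by apply: dirac_on_lattice; exists 0 => //; rewrite mulr0.
by rewrite dirac_char_fun mulr0 cos0 sin0.
Qed.

Lemma lattice_cfM a phi psi : lattice_cf a phi -> lattice_cf a psi ->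
  lattice_cf a (fun t => phi t * psi t).
Proof.
move=> [mu [amu mu_phi]] [nu [anu nu_psi]].
have [rho [rhoE arho]] := ex_convolution mu nu.
exists rho; split=> [|t]; first exact: arho.
by rewrite rhoE mu_phi nu_psi rmorphM.
Qed.

Lemma lattice_cfX a phi n : lattice_cf a phi -> lattice_cf a (fun t => phi t ^+ n).
Proof.
move=> aphi; elim: n => [|n IH]; first exact: lattice_cf1.
by apply: eq_lattice_cf (lattice_cfM aphi IH) => t; rewrite exprS.
Qed.

(** The fair mixture of the Dirac masses at a and - a. *)
Lemma lattice_cf_cos a : lattice_cf a (fun t => cos (a * t)).
Proof.
(* Atoms beyond the second get weight zero. *)
pose x_ n : measurableTypeR R := if n is 0 then a else - a.
pose mu_ n : probability (measurableTypeR R) R := \d_(x_ n).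
pose w n : R := if (n < 2)%N then 2^-1 else 0.
have sw (u : nat -> R) :
    series (fun n => w n * u n) @ \oo --> 2^-1 * u 0 + 2^-1 * u 1.
  apply: cvg_near_cst; exists 2 => // n /= n2.
  rewrite /series/= (big_cat_nat _ n2)//= big_nat_recr//= big_nat1.
  by rewrite big_nat_cond big1 ?addr0// => k /andP[/andP[k2 _] _];
    rewrite /w ltnNge k2 mul0r.
have w0 n : 0 <= w n by rewrite /w; case: ifP.
have w1 : series w @ \oo --> (1 : R).
  have -> : w = (fun n => w n * 1) by apply/funext => n; rewrite mulr1.
  by rewrite [X in _ --> X](_ : _ = 2^-1 * 1 + 2^-1 * 1); [exact: (sw (cst 1))|field].
have [mu [mu1 mu_int]] := ex_mixture mu_ w0 w1.
exists mu; split=> [|t].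
  apply: mu1 => [|[|n]]; first exact: measurable_lattice.
    by apply: dirac_on_lattice; exists 1 => //; rewrite mulr1.
  by apply: dirac_on_lattice; exists (-1) => //; rewrite mulrN1z mulrN1.
have mean (f : measurableTypeR R -> R) : measurable_fun setT f ->
    (forall x, `|f x| <= 1) -> (forall n, Rintegral (mu_ n) setT f = f (x_ n)) ->
    Rintegral mu setT f = 2^-1 * f a + 2^-1 * f (- a).
  move=> mf f1 fE; have := mu_int f 1 mf f1.
  have -> : (fun n => w n * Rintegral (mu_ n) setT f) =
      (fun n => w n * f (x_ n)) by apply/funext => n; congr (_ * _); exact: fE.
  by move=> muf; apply: cvg_unique muf (sw (f \o x_)).
have mu_cf n := dirac_char_fun (x_ n) t.
rewrite char_funE; congr (_ +i* _).
  rewrite (mean _ (measurable_cosM t) (fun x => cos_max (t * x))).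
    by rewrite mulrN cosN (mulrC t); field.
  by move=> n; have := mu_cf n; rewrite char_funE => -[].
rewrite (mean _ (measurable_sinM t) (fun x => sin_max (t * x))).
  by rewrite mulrN sinN; field.
by move=> n; have := mu_cf n; rewrite char_funE => -[].
Qed.

(** The compound Poisson construction: a sum of independent copies whose number
    is Poisson distributed with mean c. *)
Lemma lattice_cf_expR a phi (c : R) : 0 <= c -> lattice_cf a phi ->
  lattice_cf a (fun t => expR (c * (phi t - 1))).
Proof.
move=> c0 aphi.
have cvg_exp x : series (exp_coeff x) @ \oo --> expR x.
  exact: is_cvg_series_exp_coeff.
have sE x : series (fun m => expR (- c) * exp_coeff x m) @ \oo
    --> expR (- c) * expR x.
  have -> : series (fun m => expR (- c) * exp_coeff x m) =
            (fun n => expR (- c) * series (exp_coeff x) n).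
    by apply/funext => n; rewrite /series/= mulr_sumr.
  by apply: cvgM; [exact: cvg_cst|exact: cvg_exp].
apply: (@lattice_cf_mixture a (fun m t => phi t ^+ m)
          (fun m => expR (- c) * exp_coeff c m)) => [m|m||t].
- exact: lattice_cfX.
- by rewrite mulr_ge0 ?expR_ge0// exp_coeff_ge0.
- by have H := sE c; rewrite -expRD addNr expR0 in H; exact: H.
have -> : expR (c * (phi t - 1)) = expR (- c) * expR (c * phi t).
  by rewrite -expRD; congr expR; ring.
have -> : (fun m => expR (- c) * exp_coeff c m * phi t ^+ m) =
          (fun m => expR (- c) * exp_coeff (c * phi t) m).
  by apply/funext => m; rewrite /exp_coeff/= exprMn; ring.
exact: sE.
Qed.

(** The random walk with steps a and - a, observed at an independent random time
    that equals k + 1 with probability b_k. *)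
Lemma lattice_cf_powR a gamma : 0 < gamma <= 1 ->
  lattice_cf a (fun t => 1 - (1 - cos (a * t)) `^ gamma).
Proof.
move=> gamma01.
have sE z : `|z| <= 1 -> series (fun k => bincoef gamma k * z ^+ k.+1) @ \oo
    --> 1 - (1 - z) `^ gamma.
  move=> z1; have -> : series (fun k => bincoef gamma k * z ^+ k.+1) =
      (fun n => 1 - binrem gamma n z).
    by apply/funext => n; rewrite /series/= big_mkord /binrem subKr.
  by apply: cvgB; [exact: cvg_cst|exact: binrem_cvg].
apply: (@lattice_cf_mixture a (fun k t => cos (a * t) ^+ k.+1)
          (bincoef gamma)) => [k|k||t].
- exact: lattice_cfX (lattice_cf_cos a).
- exact: bincoef_ge0.
- (* At z = 1 the series is that of the weights. *)
  have := sE 1; rewrite normr1 subrr powR0 ?subr0; last first.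
    by rewrite gt_eqF//; have /andP[] := gamma01.
  have -> : (fun k => bincoef gamma k * 1 ^+ k.+1) = bincoef gamma.
    by apply/funext => k; rewrite expr1n mulr1.
  by apply.
- by apply: sE; exact: cos_max.
Qed.

End Lattice.

Theorem lemma2p1 (R : realType) (alpha gamma sigma : R)
    (halpha : 0 < alpha <= 2) (hgamma : gamma = alpha / 2)
    (hsigma : 0 < sigma) (a : R) (ha : 0 < a) :
  exists mu : probability (measurableTypeR R) R,
    on_lattice mu a /\
    forall t : R, char_fun mu t = (g gamma sigma t a)%:C.
Proof.
have gamma01 : 0 < gamma <= 1 by rewrite hgamma; lra.
pose c := sigma `^ (2 * gamma) * (2 `^ gamma / a `^ (2 * gamma)).
have c0 : 0 <= c by rewrite /c !mulr_ge0 ?invr_ge0 ?powR_ge0.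
apply: eq_lattice_cf (lattice_cf_expR c0 (lattice_cf_powR a gamma01)) => t.
by rewrite /g; congr expR; rewrite /c; ring.
Qed.
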